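(* Let $\mathcal Y$ be an AM-space with unit $\mathbf 1$ and suppose that there exist $u_0\in\operatorname{dom}(\mathcal J)$ and $v_0\in\operatorname{dom}(\mathcal H(\cdot\mid f))$ such that $$A^lu_0+\varepsilon\mathbf 1\le v_0\le A^uu_0-\varepsilon\mathbf 1,$$ where $\varepsilon>0$ is a constant. Then Robinson's condition is satisfied in the problem $$\min_{u\in\mathcal X,\ v\in\mathcal Y,\ Bu\le Ev}\ \frac1\alpha\mathcal H(v\mid f)+\mathcal J(u),$$ that is, $$0\in\operatorname{int}\bigl(L(\operatorname{dom}g)-K\bigr),$$ where $g(u,v)=\frac1\alpha\mathcal H(v\mid f)+\mathcal J(u)$ on $\mathcal X\times\mathcal Y$, $L(u,v)=Bu-Ev\in\mathcal Y\times\mathcal Y$ and $K=\mathcal Y_-\times\mathcal Y_-$, with $\mathcal Y_-=\{y\in\mathcal Y:y\le0\}$.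
   Context: $\mathcal X=\mathcal U^*$ and $\mathcal Y=\mathcal V^*$ are duals of Banach lattices with the dual norm and dual partial order ($y\ge0$ iff $\langle y,v\rangle\ge0$ for all $v\in\mathcal V$, $v\ge0$). $A^l,A^u:\mathcal X\to\mathcal Y$ are bounded linear operators, $f\in\mathcal Y$ and $\alpha>0$ are fixed. $\mathcal J:\mathcal X\to[0,+\infty]$ and $\mathcal H(\cdot\mid f):\mathcal Y\to[0,+\infty]$ are proper, convex and weakly-* lower semicontinuous. $Bu=(A^lu,-A^uu)$ and $Ev=(v,-v)$, with componentwise order on $\mathcal Y\times\mathcal Y$. A Banach lattice $\mathcal Y$ is an AM-space if $\|x\vee y\|=\|x\|\vee\|y\|$ for all $x,y\ge0$; an element $\mathbf 1\in\mathcal Y$ is a unit if $\mathbf 1\ge0$, $\|\mathbf 1\|=1$ and $\|x\|\le1\Rightarrow|x|\le\mathbf 1$. *)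

(* Defs.v *)
From HB Require Import structures.
From mathcomp Require Import all_boot all_order all_algebra lra.
From mathcomp Require Import all_classical all_reals all_analysis.

Set Implicit Arguments.
Unset Strict Implicit.
Unset Printing Implicit Defensive.

Import Order.TTheory GRing.Theory Num.Theory.
Import numFieldNormedType.Exports.

Local Open Scope classical_set_scope.
Local Open Scope ring_scope.

Reserved Notation "x ⪯ y" (at level 70, no associativity).
Reserved Notation "x ⊔ y" (at level 50, left associativity).

(* The order is not MathComp's Order.Lattice: Hierarchy Builder accepts no
   structure joining Order.POrder and NormedModule, the numeric structures
   already inheriting from both sides without a declared join.
   Only binary suprema are required; x ∧ y is - (- x ⊔ - y). *)
HB.mixin Record isBanachLattice (R : realType) E
    of CompleteNormedModule R E := {
  vle : E -> E -> Prop;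
  vle_refl : forall x, vle x x;
  vle_anti : forall x y, vle x y -> vle y x -> x = y;
  vle_trans : forall y x z, vle x y -> vle y z -> vle x z;
  vjoin : E -> E -> E;
  vjoin_le : forall x y z, vle (vjoin x y) z <-> vle x z /\ vle y z;
  vle_add2r : forall z x y, vle x y -> vle (x + z) (y + z);
  vle_scale : forall (a : R) x, 0 <= a -> vle 0 x -> vle 0 (a *: x);
  vle_norm : forall x y,
    vle (vjoin x (- x)) (vjoin y (- y)) -> `|x| <= `|y|;
}.

#[short(type="banachLatticeType")]
HB.structure Definition BanachLattice (R : realType) :=
  { E of CompleteNormedModule R E & isBanachLattice R E }.

Notation "x ⪯ y" := (vle x y) : ring_scope.
Notation "x ⊔ y" := (vjoin x y) : ring_scope.

Arguments vle_anti {R s} [x y].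
Arguments vle_trans {R s} [y x z].
Arguments vjoin_le {R s} {x y z}.
Arguments vle_add2r {R s} z [x y].
Arguments vle_scale {R s} [a x].
Arguments vle_norm {R s} [x y].

Definition modulus (R : realType) (E : banachLatticeType R) (x : E) : E :=
  x ⊔ - x.

Definition AM_space (R : realType) (E : banachLatticeType R) : Prop :=
  forall x y : E, 0 ⪯ x -> 0 ⪯ y -> `|x ⊔ y| = Num.max `|x| `|y|.

Definition AM_unit (R : realType) (E : banachLatticeType R) (e : E) : Prop :=
  [/\ 0 ⪯ e, `|e| = 1 & forall x : E, `|x| <= 1 -> modulus x ⪯ e].

Section banach_lattice_theory.
Context {R : realType} {E : banachLatticeType R}.
Implicit Types x y z u v w : E.

Lemma vle_joinl x y : x ⪯ x ⊔ y.
Proof. by have /vjoin_le[] := vle_refl (x ⊔ y). Qed.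

Lemma vle_joinr x y : y ⪯ x ⊔ y.
Proof. by have /vjoin_le[] := vle_refl (x ⊔ y). Qed.

Lemma vle_sub0 x y : x ⪯ y <-> 0 ⪯ y - x.
Proof.
split=> [/(vle_add2r (- x))|/(vle_add2r x)]; first by rewrite subrr.
by rewrite subrK add0r.
Qed.

Lemma vle_opp x y : x ⪯ y <-> - y ⪯ - x.
Proof. by rewrite vle_sub0 [in X in _ <-> X]vle_sub0 opprK addrC. Qed.

Lemma vle_add x y u v : x ⪯ y -> u ⪯ v -> x + u ⪯ y + v.
Proof.
move=> xy uv; apply: (vle_trans (vle_add2r u xy)).
by rewrite addrC (addrC y); exact: vle_add2r.
Qed.

Lemma vle_add0 x y : 0 ⪯ x -> 0 ⪯ y -> 0 ⪯ x + y.
Proof. by move=> x0 y0; rewrite -[X in vle X _]addr0; exact: vle_add. Qed.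

Lemma vle_scale2 (a : R) x y : 0 <= a -> x ⪯ y -> a *: x ⪯ a *: y.
Proof.
by move=> a0 /vle_sub0 xy; apply/vle_sub0; rewrite -scalerBr; exact: vle_scale.
Qed.

Lemma vjoin_addr x y z : (x ⊔ y) + z = (x + z) ⊔ (y + z).
Proof.
have le1 u v w : (u + w) ⊔ (v + w) ⪯ (u ⊔ v) + w.
  by apply/vjoin_le; split; apply: vle_add2r;
    [exact: vle_joinl|exact: vle_joinr].
apply: vle_anti; last exact: le1.
have := vle_add2r z (le1 (x + z) (y + z) (- z)).
by rewrite !addrK subrK.
Qed.

Lemma vjoinC x y : x ⊔ y = y ⊔ x.
Proof.
have le1 u v : u ⊔ v ⪯ v ⊔ u.
  by apply/vjoin_le; split; [exact: vle_joinr|exact: vle_joinl].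
exact: vle_anti.
Qed.

Definition vpos x : E := x ⊔ 0.

Lemma vpos_ge0 x : 0 ⪯ vpos x.
Proof. exact: vle_joinr. Qed.

Lemma vposB x : x = vpos x - vpos (- x).
Proof.
have -> : vpos x = vpos (- x) + x.
  by rewrite /vpos vjoin_addr addNr add0r vjoinC.
by rewrite addrAC subrr add0r.
Qed.

Lemma vjoin_idr x y : x ⪯ y -> x ⊔ y = y.
Proof.
move=> xy; apply: vle_anti; last exact: vle_joinr.
by apply/vjoin_le; split => //; exact: vle_refl.
Qed.

Lemma modulus_pos x : 0 ⪯ x -> modulus x = x.
Proof.
move=> x0; rewrite /modulus vjoinC; apply: vjoin_idr.
by apply: (vle_trans _ x0); apply/vle_sub0; rewrite opprK add0r.
Qed.

Lemma modulusN x : modulus (- x) = modulus x.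
Proof. by rewrite /modulus opprK vjoinC. Qed.

Lemma modulus_ge0 x : 0 ⪯ modulus x.
Proof.
have h : 0 ⪯ (2 : R) *: modulus x.
  rewrite scaler_nat mulr2n -[X in vle X _](subrr x).
  by apply: vle_add; [exact: vle_joinl|exact: vle_joinr].
have := @vle_scale _ _ 2^-1 _ _ h.
by rewrite scalerA mulVf ?pnatr_eq0// scale1r; apply; rewrite invr_ge0.
Qed.

Lemma norm_vle x y : modulus x ⪯ y -> `|x| <= `|y|.
Proof.
move=> xy; apply: vle_norm; rewrite -/(modulus x) -/(modulus y).
rewrite (@modulus_pos y)//.
by apply: (vle_trans _ xy); exact: modulus_ge0.
Qed.

Lemma norm_modulus x : `|modulus x| = `|x|.
Proof.
apply/eqP; rewrite eq_le; apply/andP; split; last first.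
  by apply: norm_vle; exact: vle_refl.
apply: vle_norm; rewrite -!/(modulus _) modulus_pos.
  exact: vle_refl.
exact: modulus_ge0.
Qed.

Lemma norm_vle0 x y : 0 ⪯ x -> x ⪯ y -> `|x| <= `|y|.
Proof. by move=> x0 xy; apply: norm_vle; rewrite modulus_pos. Qed.

Lemma norm_vpos x : `|vpos x| <= `|x|.
Proof.
rewrite -(norm_modulus x); apply: norm_vle0; first exact: vpos_ge0.
by apply/vjoin_le; split; [exact: vle_joinl|exact: modulus_ge0].
Qed.

Lemma vle_riesz u v w : 0 ⪯ u -> 0 ⪯ v -> 0 ⪯ w -> w ⪯ u + v ->
  exists w1 w2, [/\ w = w1 + w2, 0 ⪯ w1 /\ w1 ⪯ u & 0 ⪯ w2 /\ w2 ⪯ v].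
Proof.
move=> u0 v0 w0 wuv; exists (w - vpos (w - u)), (vpos (w - u)).
split; first by rewrite subrK.
- split.
    apply/(vle_sub0 (vpos (w - u)))/vjoin_le; split => //.
    by apply/vle_sub0; rewrite opprB addrC subrK.
  have := vle_joinl (w - u) 0; rewrite -/(vpos _) => /vle_sub0.
  by rewrite opprB => h; apply/vle_sub0; rewrite opprB addrCA.
- split; first exact: vpos_ge0.
  apply/vjoin_le; split => //.
  move/vle_sub0 : wuv => h; apply/vle_sub0.
  by rewrite opprB addrA (addrC v).
Qed.

End banach_lattice_theory.

Section normed_dual.
Context {R : realType} (U : normedModType R).

Definition continuous_linear : {pred U -> R^o} :=
  fun f => `[< linear f /\ continuous f >].

Lemma continuous_linear_submod : submod_closed continuous_linear.
Proof.
split.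
  apply/asboolP; split; last exact: cst_continuous.
  by move=> a u v /=; rewrite scaler0 addr0.
move=> a f g /asboolP[lf cf] /asboolP[lg cg]; apply/asboolP; split.
  move=> b u v; rewrite /= -![(_ + _) _]/(a *: f _ + g _) lf lg.
  by rewrite !scalerDr !scalerA (mulrC a b) addrACA.
by move=> u; apply: cvgD; [apply: cvgZr; exact: cf|exact: cg].
Qed.

HB.instance Definition _ :=
  GRing.isSubmodClosed.Build R (U -> R^o) continuous_linear
    continuous_linear_submod.

Record dual_space := Dual {
  dual_fun :> U -> R^o;
  _ : dual_fun \in continuous_linear }.

HB.instance Definition _ := [isSub for dual_fun].
HB.instance Definition _ := [Choice of dual_space by <:].
HB.instance Definition _ := [SubChoice_isSubLmodule of dual_space by <:].

Implicit Types (phi psi : dual_space) (u v : U).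

Lemma dual_linear phi : linear phi.
Proof. by case: phi => f /= /asboolP[]. Qed.

Lemma dual_continuous phi : continuous phi.
Proof. by case: phi => f /= /asboolP[]. Qed.

HB.instance Definition _ phi :=
  GRing.isLinear.Build R U R^o *:%R phi (dual_linear phi).

Lemma dual_ext phi psi : (forall u, phi u = psi u) -> phi = psi.
Proof. by move=> h; apply: val_inj; apply/funext. Qed.

Lemma dualD phi psi u : (phi + psi) u = phi u + psi u. Proof. by []. Qed.
Lemma dualN phi u : (- phi) u = - phi u. Proof. by []. Qed.
Lemma dualZ (a : R) phi u : (a *: phi) u = a * phi u. Proof. by []. Qed.
Lemma dual0 u : (0 : dual_space) u = 0. Proof. by []. Qed.

Definition dual_norm phi : R :=
  sup [set `|phi u| | u in [set u : U | `|u| <= 1]].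

Lemma dual_bounded phi : exists2 C, 0 <= C & forall u, `|phi u| <= C * `|u|.
Proof.
have /linear_bounded_continuous/linear_boundedP := @dual_continuous phi.
by move=> /pinfty_ex_gt0[C C0 hC]; exists C => //; exact: ltW.
Qed.

Let has_sup_norm phi :
  has_sup [set `|phi u| | u in [set u : U | `|u| <= 1]].
Proof.
split; first by exists `|phi 0|, 0 => //=; rewrite normr0.
have [C C0 hC] := dual_bounded phi; exists C => _ [u /= u1 <-].
by apply: (le_trans (hC u)); rewrite ler_piMr.
Qed.

Lemma dual_norm_le phi C :
  (forall u, `|u| <= 1 -> `|phi u| <= C) -> dual_norm phi <= C.
Proof.
move=> h; apply: ge_sup; first by case: (has_sup_norm phi).
by move=> _ [u /= u1 <-]; exact: h.
Qed.

Lemma dual_norm_ge0 phi : 0 <= dual_norm phi.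
Proof.
apply: ub_le_sup; first by case: (has_sup_norm phi).
by exists 0; rewrite /= ?normr0// linear0 normr0.
Qed.

Lemma dual_normP phi u : `|phi u| <= dual_norm phi * `|u|.
Proof.
have [->|u0] := eqVneq u 0; first by rewrite linear0 !normr0 mulr0.
have u_gt0 : 0 < `|u| by rewrite normr_gt0.
rewrite -ler_pdivrMr//; apply: ub_le_sup; first by case: (has_sup_norm phi).
exists (`|u|^-1 *: u); first by rewrite /= normfZV.
by rewrite linearZ /= normrZ normfV normr_id mulrC.
Qed.

Let dual_ler_normD phi psi :
  dual_norm (phi + psi) <= dual_norm phi + dual_norm psi.
Proof.
apply: dual_norm_le => u u1; rewrite dualD (le_trans (ler_normD _ _))//.
by apply: lerD; apply: (le_trans (dual_normP _ _));
  rewrite ler_piMr// dual_norm_ge0.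
Qed.

Let dual_normrZ (a : R) phi : dual_norm (a *: phi) = `|a| * dual_norm phi.
Proof.
have le1 (b : R) psi : dual_norm (b *: psi) <= `|b| * dual_norm psi.
  apply: dual_norm_le => u u1; rewrite dualZ normrM ler_wpM2l//.
  by rewrite (le_trans (dual_normP _ _))// ler_piMr// dual_norm_ge0.
apply/eqP; rewrite eq_le le1/=.
have [->|a0] := eqVneq a 0; first by rewrite normr0 mul0r dual_norm_ge0.
rewrite -ler_pdivlMl ?normr_gt0// -normfV.
by have := le1 a^-1 (a *: phi); rewrite scalerA mulVf// scale1r.
Qed.

Let dual_normr0_eq0 phi : dual_norm phi = 0 -> phi = 0.
Proof.
move=> p0; apply: dual_ext => u; apply/eqP; rewrite dual0 -normr_le0.
by rewrite (le_trans (dual_normP _ _))// p0 mul0r.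
Qed.

HB.instance Definition _ := Lmodule_isNormed.Build R dual_space
  dual_ler_normD dual_normrZ dual_normr0_eq0.

Lemma dual_normE phi : `|phi| = dual_norm phi. Proof. by []. Qed.

Lemma le_dual_norm phi u : `|phi u| <= `|phi| * `|u|.
Proof. exact: dual_normP. Qed.

Lemma bounded_continuous_linear (f : U -> R^o) (C : R) :
  linear f -> (forall u, `|f u| <= C * `|u|) -> f \in continuous_linear.
Proof.
move=> lf fC; apply/asboolP; split => //.
pose g : {linear U -> R^o} :=
  HB.pack f (GRing.isLinear.Build R U R^o *:%R f lf).
apply: (@bounded_linear_continuous _ _ _ g); apply/linear_boundedP.
near=> r => u; apply: (le_trans (fC u)); rewrite ler_wpM2r//.
Unshelve. all: by end_near. Qed.

Let dual_cauchy_cvg (F : set_system dual_space) :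
  ProperFilter F -> cauchy F -> cvg F.
Proof.
move=> FF /cauchy_ballP Fc.
have Fe e : 0 < e -> exists A B : set dual_space, [/\ F A, F B &
    forall p q u, A p -> B q -> `|p u - q u| <= e * `|u|].
  move=> e0; have [[A B] /= [FA FB] AB] := Fc _ e0.
  exists A, B; split => // p q u Ap Bq.
  have := AB (p, q) (conj Ap Bq); rewrite /= -ball_normE /= => /ltW pqe.
  by apply: (le_trans (le_dual_norm (p - q) u)); rewrite ler_wpM2r.
have cF u : cvg ((fun p : dual_space => (p u : R^o)) @ F).
  apply: cauchy_cvg; apply/cauchy_ballP => e e0.
  have d0 : 0 < e / (1 + `|u|) by rewrite divr_gt0// ltr_pwDl.
  have [A [B [FA FB AB]]] := Fe _ d0.
  pose f (p : dual_space) : R^o := p u.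
  have fF S : F S -> (f @ F) (f @` S).
    move=> FS; change (F (f @^-1` (f @` S))).
    by apply: filterS FS; exact: preimage_image.
  exists (f @` A, f @` B); first by split; exact: fF.
  move=> [_ _] [/= [p Ap <-] [q Bq <-]]; rewrite -ball_normE /=.
  apply: (le_lt_trans (AB p q u Ap Bq)).
  by rewrite mulrAC ltr_pdivrMr ?ltr_pwDl// ltr_pM2l// ltrDr.
pose l u : R^o := lim ((fun p : dual_space => (p u : R^o)) @ F).
have lP u : (fun p : dual_space => (p u : R^o)) @ F --> l u by exact: cF.
have ll : linear l.
  move=> a u v; apply: (@cvg_unique _ (@norm_hausdorff _ R^o) _ _ _ _ (lP _)).
  rewrite (_ : (fun p : dual_space => _) =
      (fun p : dual_space => a *: p u + p v)).
    by apply: cvgD; [apply: cvgZr; exact: lP|exact: lP].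
  by apply/funext => p; rewrite linearP.
have key e : 0 < e ->
    F [set q : dual_space | forall u, `|l u - q u| <= e * `|u|].
  move=> e0; have [A [B [FA FB AB]]] := Fe _ e0.
  apply: filterS FB => q Bq u; apply/ler_addgt0Pr => d d0.
  have /cvgrPdist_le/(_ _ d0) ld := lP u.
  have [p [Ap pd]] := filter_ex (filterI FA ld).
  rewrite (addrC (e * _)) -(subrK (p u) (l u)) -(addrA _ (p u)).
  by apply: (le_trans (ler_normD _ _)); apply: lerD => //; exact: AB.
have [q hq] := filter_ex (key 1 ltr01).
have lC u : `|l u| <= (1 + `|q|) * `|u|.
  rewrite -(subrK (q u) (l u)) mulrDl (le_trans (ler_normD _ _))//.
  by apply: lerD; [exact: hq|exact: le_dual_norm].
apply/cvg_ex; exists (Dual (bounded_continuous_linear ll lC)).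
apply/cvgrPdist_le => e e0; apply: filterS (key _ e0) => p hp.
apply: dual_norm_le => u u1; apply: (le_trans (hp u)).
by rewrite ler_piMr// ltW.
Qed.

HB.instance Definition _ :=
  Uniform_isComplete.Build dual_space dual_cauchy_cvg.

End normed_dual.

Section dual_order.
Context {R : realType} (U : banachLatticeType R).
Implicit Types (phi psi chi : dual_space U) (u v w : U).

Definition dual_le phi psi : Prop := forall u, 0 ⪯ u -> phi u <= psi u.

Lemma dual_le_nondecreasing phi u v : dual_le 0 phi -> u ⪯ v -> phi u <= phi v.
Proof. by move=> phi0 /vle_sub0 /phi0; rewrite dual0 linearB subr_ge0. Qed.

(* Riesz-Kantorovich formula for the positive part of phi on the cone; pos_fun
   extends it to U through u = vpos u - vpos (- u). *)
Let cone_sup phi u : R := sup [set phi w | w in [set w | 0 ⪯ w /\ w ⪯ u]].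

Let cone_sup_bound phi u w : 0 ⪯ w -> w ⪯ u -> `|phi w| <= `|phi| * `|u|.
Proof.
move=> w0 wu; apply: (le_trans (le_dual_norm _ _)).
by rewrite ler_wpM2l//; exact: norm_vle0.
Qed.

Let cone_has_sup phi u : 0 ⪯ u ->
  has_sup [set phi w | w in [set w | 0 ⪯ w /\ w ⪯ u]].
Proof.
move=> u0; split; first by exists (phi 0), 0 => //=; split => //; exact: vle_refl.
exists (`|phi| * `|u|) => _ [w [w0 wu] <-].
by apply: (le_trans (ler_norm _)); exact: cone_sup_bound.
Qed.

Let cone_sup_ub phi u w : 0 ⪯ w -> w ⪯ u -> phi w <= cone_sup phi u.
Proof.
move=> w0 wu; apply: ub_le_sup; last by exists w.
by have [] := cone_has_sup phi (vle_trans w0 wu).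
Qed.

Let cone_sup_le phi u C : 0 ⪯ u ->
  (forall w, 0 ⪯ w -> w ⪯ u -> phi w <= C) -> cone_sup phi u <= C.
Proof.
move=> u0 h; apply: ge_sup; first by have [] := cone_has_sup phi u0.
by move=> _ [w [w0 wu] <-]; exact: h.
Qed.

Let cone_sup_ge0 phi u : 0 ⪯ u -> 0 <= cone_sup phi u.
Proof. by move=> u0; rewrite -(linear0 phi) cone_sup_ub//; exact: vle_refl. Qed.

Let cone_supD phi u v : 0 ⪯ u -> 0 ⪯ v ->
  cone_sup phi (u + v) = cone_sup phi u + cone_sup phi v.
Proof.
move=> u0 v0; apply/eqP; rewrite eq_le; apply/andP; split.
  apply: cone_sup_le => [|w w0 wuv]; first exact: vle_add0.
  have [w1 [w2 [-> [w10 w1u] [w20 w2v]]]] := vle_riesz u0 v0 w0 wuv.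
  by rewrite linearD lerD// cone_sup_ub.
rewrite -lerBrDr; apply: cone_sup_le => // w1 w10 w1u.
rewrite lerBrDr addrC -lerBrDr; apply: cone_sup_le => // w2 w20 w2v.
rewrite lerBrDr addrC -linearD; apply: cone_sup_ub; first exact: vle_add0.
exact: vle_add.
Qed.

Let cone_supZ phi (a : R) u : 0 <= a -> 0 ⪯ u ->
  cone_sup phi (a *: u) = a * cone_sup phi u.
Proof.
have le1 (b : R) v : 0 < b -> 0 ⪯ v ->
    b * cone_sup phi v <= cone_sup phi (b *: v).
  move=> b0 v0; rewrite -ler_pdivlMl//; apply: cone_sup_le => // w w0 wv.
  rewrite ler_pdivlMl//.
  rewrite (_ : b * phi w = phi (b *: w)); last by rewrite linearZ.
  apply: cone_sup_ub.
    by apply: vle_scale => //; exact: ltW.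
  by apply: vle_scale2 => //; exact: ltW.
rewrite le_eqVlt => /predU1P[<- u0|a0 u0].
  apply/eqP; rewrite scale0r mul0r eq_le; apply/andP; split; last first.
    by apply: cone_sup_ge0; exact: vle_refl.
  apply: cone_sup_le => [|w w0 w0']; first exact: vle_refl.
  by rewrite (vle_anti w0' w0) linear0.
apply/eqP; rewrite eq_le le1// andbT -ler_pdivrMl//.
have ia0 : 0 < a^-1 by rewrite invr_gt0.
have := le1 a^-1 (a *: u) ia0 (vle_scale (ltW a0) u0).
by rewrite scalerA mulVf ?gt_eqF// scale1r.
Qed.

Let pos_fun phi u : R^o := cone_sup phi (vpos u) - cone_sup phi (vpos (- u)).

Let pos_funE phi u v : 0 ⪯ u -> 0 ⪯ v ->
  pos_fun phi (u - v) = cone_sup phi u - cone_sup phi v.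
Proof.
move=> u0 v0; have e : vpos (u - v) + v = u + vpos (- (u - v)).
  have -> : vpos (u - v) = u - v + vpos (- (u - v)).
    by apply/eqP; rewrite -subr_eq -vposB.
  by rewrite addrAC subrK.
have := congr1 (cone_sup phi) e.
rewrite !cone_supD//; do ?exact: vpos_ge0.
by move=> E; apply/eqP; rewrite /pos_fun subr_eq addrAC -E addrK.
Qed.

Let pos_fun_linear phi : linear (pos_fun phi).
Proof.
move=> a u v; have [p0 q0] := (vpos_ge0 u, vpos_ge0 (- u)).
have [r0 s0] := (vpos_ge0 v, vpos_ge0 (- v)).
have [a0|/ltW a0] := leP 0 a.
  have -> : a *: u + v =
      (a *: vpos u + vpos v) - (a *: vpos (- u) + vpos (- v)).
    by rewrite [in LHS](vposB u) [in LHS](vposB v) scalerBr opprD addrACA.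
  have [ap aq] := (vle_scale a0 p0, vle_scale a0 q0).
  rewrite pos_funE; [|exact: vle_add0|exact: vle_add0].
  rewrite !cone_supD// !cone_supZ// /pos_fun -[_ *: _]/(_ * _).
  by rewrite mulrBr opprD addrACA.
have b0 : 0 <= - a by rewrite oppr_ge0.
have -> : a *: u + v =
    (- a *: vpos (- u) + vpos v) - (- a *: vpos u + vpos (- v)).
  rewrite [in LHS](vposB u) [in LHS](vposB v) scalerBr opprD !scaleNr opprK.
  by rewrite (addrC (a *: _)) addrACA.
have [ap aq] := (vle_scale b0 p0, vle_scale b0 q0).
rewrite pos_funE; [|exact: vle_add0|exact: vle_add0].
rewrite !cone_supD// !cone_supZ// /pos_fun -[_ *: _]/(_ * _).
by rewrite !mulNr opprD opprK mulrBr addrACA; congr (_ + _); exact: addrC.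
Qed.

Let pos_fun_bounded phi u : `|pos_fun phi u| <= (2 * `|phi|) * `|u|.
Proof.
have le1 v : `|cone_sup phi (vpos v)| <= `|phi| * `|v|.
  rewrite ger0_norm; last by apply: cone_sup_ge0; exact: vpos_ge0.
  apply: cone_sup_le => [|w w0 wv]; first exact: vpos_ge0.
  apply: (le_trans (ler_norm _)); apply: (le_trans (cone_sup_bound phi w0 wv)).
  by rewrite ler_wpM2l// norm_vpos.
apply: (le_trans (ler_normB _ _)).
rewrite mulrDl mul1r mulrDl; apply: lerD => //.
by have := le1 (- u); rewrite normrN.
Qed.

Definition dual_pos phi : dual_space U :=
  Dual (bounded_continuous_linear (@pos_fun_linear phi) (pos_fun_bounded phi)).

Let dual_posE phi u : 0 ⪯ u ->
  dual_pos phi u = sup [set phi w | w in [set w | 0 ⪯ w /\ w ⪯ u]].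
Proof.
move=> u0; have := pos_funE phi u0 (vle_refl 0); rewrite subr0 => h.
have c0 : cone_sup phi 0 = 0.
  by have := cone_supZ phi (lexx 0) (vle_refl 0); rewrite scale0r mul0r.
by rewrite -[LHS]/(pos_fun phi u) h c0 subr0.
Qed.

Definition dual_join phi psi : dual_space U := psi + dual_pos (phi - psi).

Let dual_le_refl phi : dual_le phi phi. Proof. by []. Qed.

Let dual_le_anti phi psi : dual_le phi psi -> dual_le psi phi -> phi = psi.
Proof.
move=> h1 h2; apply: dual_ext => u; rewrite (vposB u) !linearB.
by congr (_ - _); apply/eqP; rewrite eq_le h1 ?h2//; exact: vpos_ge0.
Qed.

Let dual_le_trans psi phi chi :
  dual_le phi psi -> dual_le psi chi -> dual_le phi chi.
Proof. by move=> h1 h2 u u0; exact: le_trans (h1 _ u0) (h2 _ u0). Qed.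

Let dual_join_le phi psi chi :
  dual_le (dual_join phi psi) chi <-> dual_le phi chi /\ dual_le psi chi.
Proof.
split=> [h|[h1 h2] u u0].
  split=> u u0; apply: le_trans (h u u0); rewrite dualD dual_posE//.
    by rewrite addrC -lerBlDr; exact: (@cone_sup_ub (phi - psi)) (vle_refl _).
  by rewrite lerDl; exact: cone_sup_ge0.
rewrite dualD dual_posE// addrC -lerBrDr.
apply: (@cone_sup_le (phi - psi)) => // w w0 wu.
rewrite dualD dualN lerBlDr (le_trans (h1 _ w0))//.
have : dual_le 0 (chi - psi).
  by move=> v v0; rewrite dualD dualN subr_ge0 h2.
move=> /dual_le_nondecreasing/(_ wu); rewrite !dualD !dualN => h.
by rewrite -lerBlDr.
Qed.

Let dual_le_add2r chi phi psi :
  dual_le phi psi -> dual_le (phi + chi) (psi + chi).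
Proof. by move=> h u u0; rewrite !dualD lerD2r h. Qed.

Let dual_le_scale (a : R) phi : 0 <= a -> dual_le 0 phi -> dual_le 0 (a *: phi).
Proof. by move=> a0 h u u0; rewrite dualZ mulr_ge0//; exact: h. Qed.

Let dual_join_norm phi u : 0 ⪯ u -> dual_join phi (- phi) u <= `|phi| * `|u|.
Proof.
move=> u0; rewrite dualD dual_posE// addrC -lerBrDr.
apply: (@cone_sup_le (phi - - phi)) => // w w0 wu.
rewrite lerBrDr.
have -> : (phi - - phi) w + (- phi) u = phi (w + w - u).
  by rewrite dualD !dualN opprK linearB linearD.
apply: (le_trans (ler_norm _)); apply: (le_trans (le_dual_norm _ _)).
rewrite ler_wpM2l//; apply: norm_vle.
apply/vjoin_le; split; apply/vle_sub0.
  rewrite opprB addrA opprD addrACA.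
  by move/vle_sub0 : wu => h; exact: vle_add0.
by rewrite opprK addrC subrK; exact: vle_add0.
Qed.

Let dual_vle_norm phi psi :
  dual_le (dual_join phi (- phi)) (dual_join psi (- psi)) -> `|phi| <= `|psi|.
Proof.
move=> h; apply: dual_norm_le => u u1.
have m0 := modulus_ge0 u.
apply: (@le_trans _ _ (`|psi| * `|modulus u|)); last first.
  by rewrite norm_modulus ler_piMr.
apply: le_trans (dual_join_norm psi m0); apply: le_trans (h _ m0).
have [j1 j2] := (dual_join_le phi (- phi) _).1 (@dual_le_refl _).
have mB : 0 ⪯ modulus u - u by exact: ((vle_sub0 _ _).1 (vle_joinl _ _)).
have mD : 0 ⪯ modulus u + u.
  by have := (vle_sub0 _ _).1 (vle_joinr u (- u)); rewrite opprK.
have lD chi v w : chi (v + w) = chi v + chi w by exact: linearD.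
have lB chi v w : chi (v - w) = chi v - chi w by exact: linearB.
have := (j1 _ mD, j1 _ mB, j2 _ mD, j2 _ mB).
rewrite !dualN !lB !lD ler_norml.
move: (phi (modulus u)) (phi u) (dual_join _ _ (modulus u)) (dual_join _ _ u).
move=> a b c d.
by move=> [[[h1 h2] h3] h4]; apply/andP; split; lra.
Qed.

HB.instance Definition _ := isBanachLattice.Build R (dual_space U)
  dual_le_refl dual_le_anti dual_le_trans dual_join_le dual_le_add2r
  dual_le_scale dual_vle_norm.

End dual_order.

(* The topology of pointwise convergence on U, carried by an alias of
   dual_space U so that it does not compete with the norm topology. *)
Definition weak_star (R : realType) (U : normedModType R) : Type :=
  initial_topology (fun phi : dual_space U => (phi : {ptws U -> R^o})).

HB.instance Definition _ (R : realType) (U : normedModType R) :=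
  Topological.copy (weak_star U)
    (initial_topology (fun phi : dual_space U => (phi : {ptws U -> R^o}))).

Definition weak_star_lsc (R : realType) (U : normedModType R)
    (f : dual_space U -> \bar R) : Prop :=
  lower_semicontinuous (f : weak_star U -> \bar R).

Definition effective_domain (R : realType) (T : Type) (f : T -> \bar R) :
    set T :=
  [set x | (f x < +oo)%E].

Definition proper_function (R : realType) (T : Type) (f : T -> \bar R) : Prop :=
  effective_domain f !=set0 /\ forall x, (-oo < f x)%E.

(* Used for functions with values in [0, +oo] only, where the products and
   sums below are the usual ones, with 0 * +oo = 0. *)
Definition convex_efunction (R : realType) (E : lmodType R)
    (f : E -> \bar R) : Prop :=
  forall (x y : E) (t : R), 0 <= t <= 1 ->
    (f (t *: x + (1 - t) *: y)%R <= t%:E * f x + (1 - t)%:E * f y)%E.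

Definition bounded_operator (R : realType) (E F : normedModType R)
    (A : {linear E -> F}) : Prop :=
  exists C : R, forall x, `|A x| <= C * `|x|.

(* Robinson's condition for minimising g subject to L x \in K. *)
Definition robinson_condition (R : realType) (E F : normedModType R)
    (g : E -> \bar R) (L : E -> F) (K : set F) : Prop :=
  interior [set y - k | y in L @` effective_domain g & k in K] 0.

Section order_constrained_problem.
Context {R : realType} {X : normedModType R} {Y : banachLatticeType R}.

Definition objective (alpha : R) (H : Y -> \bar R) (J : X -> \bar R)
    (uv : X * Y) : \bar R :=
  ((alpha^-1)%:E * H uv.2 + J uv.1)%E.

Definition operB (Al Au : X -> Y) (u : X) : Y * Y := (Al u, - Au u).

Definition operE (v : Y) : Y * Y := (v, - v).

Definition constraint (Al Au : X -> Y) (uv : X * Y) : Y * Y :=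
  operB Al Au uv.1 - operE uv.2.

Definition nonpos_cone : set (Y * Y) :=
  [set y : Y | y ⪯ 0] `*` [set y : Y | y ⪯ 0].

Lemma constraintP (Al Au : X -> Y) (u : X) (v : Y) :
  nonpos_cone (constraint Al Au (u, v)) <->
  (operB Al Au u).1 ⪯ (operE v).1 /\ (operB Al Au u).2 ⪯ (operE v).2.
Proof.
have le0 (x y : Y) : x - y ⪯ 0 <-> x ⪯ y.
  by rewrite vle_sub0 sub0r opprB -vle_sub0.
by split=> -[/le0 h1 /le0 h2]; split => //; exact/le0.
Qed.

End order_constrained_problem.

(* Main.v *)
Require Import Defs.
From HB Require Import structures.
From mathcomp Require Import all_boot all_order all_algebra.
From mathcomp Require Import all_classical all_reals all_analysis.

Set Implicit Arguments.
Unset Strict Implicit.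
Unset Printing Implicit Defensive.

Import Order.TTheory GRing.Theory Num.Theory.
Import numFieldNormedType.Exports.

Local Open Scope classical_set_scope.
Local Open Scope ring_scope.

(** The order unit turns a strict order inequality into a norm estimate: the
    closed ball of radius [eps] lies in the order interval
    [[- eps e, eps e]], by rescaling the inequality that defines the unit
    ([AM_unit_vle]). The hypothesis says exactly that at [(u0, v0)] both
    components of the constraint value [y = L (u0, v0)] are at most [- eps e],
    so every [z] with norm below [eps] satisfies [y - z <= 0]
    ([nonpos_coneB_ball]). Then [z = y - (y - z)] exhibits the whole open ball
    inside [L (dom g) - K], the single point [(u0, v0)] of the domain being
    enough. *)

Lemma AM_unit_vle (R : realType) (Y : banachLatticeType R) (e y : Y) (r : R) :
  AM_unit e -> 0 < r -> `|y| <= r -> y ⪯ r *: e.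
Proof.
move=> [_ _ eP] r0 yr.
have /eP ye : `|r^-1 *: y| <= 1.
  by rewrite normrZ gtr0_norm ?invr_gt0// ler_pdivrMl// mulr1.
have := vle_scale2 (ltW r0) (vle_trans (vle_joinl _ _) ye).
by rewrite scalerA divff ?gt_eqF// scale1r.
Qed.

(** The product carries the maximum norm, so a perturbation of norm below [eps]
    moves each component by at most [eps e], which is exactly the available
    slack: this is why the radius needs no constant. *)
Lemma nonpos_coneB_ball (R : realType) (Y : banachLatticeType R) (e : Y)
    (eps : R) (y z : Y * Y) :
  AM_unit e -> 0 < eps ->
  y.1 ⪯ - (eps *: e) -> y.2 ⪯ - (eps *: e) -> ball 0 eps z ->
  nonpos_cone (y - z).
Proof.
move=> he eps0 y1 y2.
have le0 (a b : Y) : a ⪯ - (eps *: e) -> ball 0 eps b -> a - b ⪯ 0.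
  rewrite -ball_normE /= sub0r => ae /ltW b_eps.
  rewrite -(addNr (eps *: e)); apply: vle_add ae _.
  exact: AM_unit_vle.
by move=> [z1 z2]; split; exact: le0.
Qed.

Lemma effective_domain_objective (R : realType) (X : normedModType R)
    (Y : banachLatticeType R) (alpha : R) (H : Y -> \bar R) (J : X -> \bar R)
    (u : X) (v : Y) :
  0 < alpha -> (0 <= H v)%E ->
  effective_domain J u -> effective_domain H v ->
  effective_domain (objective alpha H J) (u, v).
Proof.
rewrite /effective_domain /objective /= => alpha0 H0 Ju Hv.
by rewrite lte_add_pinfty// lte_mul_pinfty// lee_fin invr_ge0 ltW.
Qed.

Theorem theorem2p6 (R : realType) (U V : banachLatticeType R)
  (Al Au : {linear dual_space U -> dual_space V}) (f : dual_space V) (alpha : R)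
  (J : dual_space U -> \bar R) (H : dual_space V -> dual_space V -> \bar R)
  (hAl : bounded_operator Al) (hAu : bounded_operator Au)
  (halpha : 0 < alpha)
  (J_ge0 : forall u, (0 <= J u)%E) (J_proper : proper_function J)
  (J_convex : convex_efunction J) (J_lsc : weak_star_lsc J)
  (H_ge0 : forall v, (0 <= H v f)%E) (H_proper : proper_function (H ^~ f))
  (H_convex : convex_efunction (H ^~ f)) (H_lsc : weak_star_lsc (H ^~ f))
  (e : dual_space V) (hAM : AM_space (dual_space V)) (he : AM_unit e)
  (hslater : exists (u0 : dual_space U) (v0 : dual_space V) (eps : R),
    [/\ effective_domain J u0, effective_domain (H ^~ f) v0, 0 < eps,
        Al u0 + eps *: e ⪯ v0 & v0 ⪯ Au u0 - eps *: e]) :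
  robinson_condition (objective alpha (H ^~ f) J)
    (constraint Al Au) (nonpos_cone : set (dual_space V * dual_space V)).
Proof.
have [u0 [v0 [eps [Ju0 Hv0 eps0 Al_le Au_ge]]]] := hslater.
pose y := constraint Al Au (u0, v0).
have y1 : y.1 ⪯ - (eps *: e).
  have := vle_add2r (- v0 - eps *: e) Al_le.
  by rewrite addrACA subrr addr0 addrA subrr add0r.
have y2 : y.2 ⪯ - (eps *: e).
  have := vle_add2r (- Au u0) Au_ge.
  by rewrite addrAC subrr add0r /y /= opprK addrC.
rewrite /robinson_condition /interior; apply/nbhs_ballP.
exists eps => //= z z_eps.
exists y.
  by exists (u0, v0) => //; exact: effective_domain_objective.
exists (y - z); first exact: (nonpos_coneB_ball he eps0).
by rewrite subKr.
Qed.
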